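(* (Minkowski inequality) Let $p\in(1,\infty)$ and let $A$ and $B$ be weighted geometric mean closed Archimedean $\Phi$-algebras over $\mathbb{K}$. For every positive linear map $T\colon A\to B$, every $n\in\mathbb{N}$ and all $a_1,\dots,a_n\in A$, $\Bigl(T\bigl(\bigl|\sum_{k=1}^na_k\bigr|^p\bigr)\Bigr)^{1/p}\le\sum_{k=1}^n\bigl(T(|a_k|^p)\bigr)^{1/p}$.
   Context: $\mathbb{K}$ denotes $\mathbb{R}$ or $\mathbb{C}$. An Archimedean vector lattice over $\mathbb{C}$ is $E+iE$ where $E$ is an Archimedean real vector lattice in which $\sup\{(\cos\theta)f+(\sin\theta)g:\theta\in[0,2\pi]\}$ exists for all $f,g$, with modulus $|f+ig|$ equal to that supremum; over $\mathbb{R}$ it is an Archimedean real vector lattice with $|f|=f\vee(-f)$. $A^+=\{a:|a|=a\}$, $A_\rho=A^+-A^+$ with its real lattice order. An Archimedean $\Phi$-algebra over $\mathbb{K}$: $A_\rho$ is an $f$-algebra with multiplicative identity $e$ (multiplication extended complex-bilinearly in the complex case). $A$ is weighted geometric mean closed if for all $f_1,\dots,f_n\in A$, $r_k\in(0,1)$ with $\sum r_k=1$, $\inf\{\sum r_k\theta_k|f_k|:\theta_k>0,\ \prod\theta_k^{r_k}=1\}$ exists in $A$. For $a\in A^+$ and $r\in(0,\infty)$, with $\lfloor r\rfloor=\max\{n\in\mathbb{N}\cup\{0\}:n\le r\}$ and $\tilde r=r-\lfloor r\rfloor$, $a^r=a^{\lfloor r\rfloor}\inf\{\tilde r\theta_1a+(1-\tilde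 r)\theta_2e:\theta_1,\theta_2>0,\ \theta_1^{\tilde r}\theta_2^{1-\tilde r}=1\}$, with $a^0=e$ and the infimum taken to be $e$ when $\tilde r=0$. A linear map $T$ is positive if $T(A^+)\subseteq B^+$. *)

(* Defs.v *)
From Stdlib Require Import Reals ZArith ClassicalEpsilon.
Open Scope R_scope.

(* Archimedean real f-algebras with multiplicative identity            *)
(* (= A_rho of an Archimedean Phi-algebra).                            *)
Record FAlg := {
  car :> Type;
  zero : car;
  add : car -> car -> car;
  opp : car -> car;
  scal : R -> car -> car;
  le : car -> car -> Prop;
  join : car -> car -> car;
  mul : car -> car -> car;
  one : car;
  addA : forall x y z, add x (add y z) = add (add x y) z;
  addC : forall x y, add x y = add y x;
  add0 : forall x, add zero x = x;
  addN : forall x, add x (opp x) = zero;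
  scalA : forall a b x, scal a (scal b x) = scal (a * b) x;
  scal1 : forall x, scal 1 x = x;
  scalDr : forall a x y, scal a (add x y) = add (scal a x) (scal a y);
  scalDl : forall a b x, scal (a + b) x = add (scal a x) (scal b x);
  le_refl : forall x, le x x;
  le_anti : forall x y, le x y -> le y x -> x = y;
  le_trans : forall x y z, le x y -> le y z -> le x z;
  le_add : forall x y z, le x y -> le (add x z) (add y z);
  le_scal : forall a x y, 0 <= a -> le x y -> le (scal a x) (scal a y);
  join_ubl : forall x y, le x (join x y);
  join_ubr : forall x y, le y (join x y);
  join_lub : forall x y z, le x z -> le y z -> le (join x y) z;
  archi : forall x y, le zero x -> (forall n : nat, le (scal (INR n) x) y) -> x = zero;
  mulA : forall x y z, mul x (mul y z) = mul (mul x y) z;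
  mulDl : forall x y z, mul (add x y) z = add (mul x z) (mul y z);
  mulDr : forall x y z, mul x (add y z) = add (mul x y) (mul x z);
  mulZl : forall a x y, mul (scal a x) y = scal a (mul x y);
  mulZr : forall a x y, mul x (scal a y) = scal a (mul x y);
  mul_pos : forall x y, le zero x -> le zero y -> le zero (mul x y);
  (* f-algebra property: x /\ y = 0, z >= 0  ==>  zx /\ y = xz /\ y = 0 *)
  f_prop_l : forall x y z, opp (join (opp x) (opp y)) = zero -> le zero z ->
               opp (join (opp (mul z x)) (opp y)) = zero;
  f_prop_r : forall x y z, opp (join (opp x) (opp y)) = zero -> le zero z ->
               opp (join (opp (mul x z)) (opp y)) = zero;
  mul1l : forall x, mul one x = x;
  mul1r : forall x, mul x one = x
}.

Arguments zero {_}. Arguments add {_}. Arguments opp {_}. Arguments scal {_}.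
Arguments le {_}. Arguments join {_}. Arguments mul {_}. Arguments one {_}.

Section FAlgDefs.
Variable E : FAlg.

Definition is_sup (S : E -> Prop) (x : E) : Prop :=
  (forall y, S y -> le y x) /\ (forall z, (forall y, S y -> le y z) -> le x z).
Definition is_inf (S : E -> Prop) (x : E) : Prop :=
  (forall y, S y -> le x y) /\ (forall z, (forall y, S y -> le z y) -> le z x).

(* the supremum / infimum (unique when it exists) *)
Definition supE (S : E -> Prop) : E := epsilon (inhabits zero) (is_sup S).
Definition infE (S : E -> Prop) : E := epsilon (inhabits zero) (is_inf S).

Fixpoint sumE (n : nat) (f : nat -> E) : E :=
  match n with O => zero | S m => add (sumE m f) (f m) end.

Fixpoint npow (a : E) (n : nat) : E :=
  match n with O => one | S m => mul a (npow a m) end.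

Definition fracpow (a : E) (s : R) : E :=
  if Req_EM_T s 0 then one else
  infE (fun h => exists t1 t2 : R, 0 < t1 /\ 0 < t2 /\
          Rpower t1 s * Rpower t2 (1 - s) = 1 /\
          h = add (scal (s * t1) a) (scal ((1 - s) * t2) one)).

Definition powE (a : E) (r : R) : E :=
  mul (npow a (Z.to_nat (Int_part r))) (fracpow a (frac_part r)).
End FAlgDefs.

Fixpoint sumR (n : nat) (f : nat -> R) : R :=
  match n with O => 0 | S m => sumR m f + f m end.
Fixpoint prodR (n : nat) (f : nat -> R) : R :=
  match n with O => 1 | S m => prodR m f * f m end.

(* Scalar field K = R or C; the Phi-algebra over K built on A_rho = E. *)
(* Over C the algebra is E + iE, represented as pairs (re, im).        *)
Inductive KField := KR | KC.

Definition scalar (K : KField) : Type :=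
  match K with KR => R | KC => (R * R)%type end.

Definition carK (K : KField) (E : FAlg) : Type :=
  match K with KR => car E | KC => (car E * car E)%type end.

Definition zeroK (K : KField) (E : FAlg) : carK K E :=
  match K return carK K E with KR => zero | KC => (zero, zero) end.

Definition addK (K : KField) (E : FAlg) : carK K E -> carK K E -> carK K E :=
  match K return carK K E -> carK K E -> carK K E with
  | KR => fun x y => add x y
  | KC => fun x y => (add (fst x) (fst y), add (snd x) (snd y))
  end.

(* (al + i be)(f + i g) = (al f - be g) + i (be f + al g) *)
Definition scalK (K : KField) (E : FAlg) : scalar K -> carK K E -> carK K E :=
  match K return scalar K -> carK K E -> carK K E with
  | KR => fun a x => scal a x
  | KC => fun c x =>
      (add (scal (fst c) (fst x)) (opp (scal (snd c) (snd x))),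
       add (scal (snd c) (fst x)) (scal (fst c) (snd x)))
  end.

Definition absK (K : KField) (E : FAlg) : carK K E -> carK K E :=
  match K return carK K E -> carK K E with
  | KR => fun f => join f (opp f)
  | KC => fun x => (supE E (fun h => exists th : R, 0 <= th <= 2 * PI /\
                      h = add (scal (cos th) (fst x)) (scal (sin th) (snd x))),
                    zero)
  end.

Definition reK (K : KField) (E : FAlg) : carK K E -> car E :=
  match K return carK K E -> car E with KR => fun x => x | KC => fun x => fst x end.
Definition embK (K : KField) (E : FAlg) : car E -> carK K E :=
  match K return car E -> carK K E with KR => fun x => x | KC => fun x => (x, zero) end.

(* the order of A: x <= y iff y - x is in A^+ (over C: real parts ordered, equal imaginary parts) *)
Definition leK (K : KField) (E : FAlg) : carK K E -> carK K E -> Prop :=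
  match K return carK K E -> carK K E -> Prop with
  | KR => fun x y => le x y
  | KC => fun x y => le (fst x) (fst y) /\ snd x = snd y
  end.

Fixpoint sumK (K : KField) (E : FAlg) (n : nat) (f : nat -> carK K E) : carK K E :=
  match n with O => zeroK K E | S m => addK K E (sumK K E m f) (f m) end.

(* E + iE is an Archimedean vector lattice over K: over C the sups exist *)
Definition vl_over (K : KField) (E : FAlg) : Prop :=
  match K with
  | KR => True
  | KC => forall f g : car E, exists s, is_sup E (fun h => exists th : R,
            0 <= th <= 2 * PI /\ h = add (scal (cos th) f) (scal (sin th) g)) s
  end.

Definition posK (K : KField) (E : FAlg) (a : carK K E) : Prop := absK K E a = a.

(* a^r for a in A^+ (computed in A_rho, which contains A^+) *)
Definition powK (K : KField) (E : FAlg) (a : carK K E) (r : R) : carK K E :=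
  embK K E (powE E (reK K E a) r).

Definition wgm_closed (K : KField) (E : FAlg) : Prop :=
  forall (n : nat) (f : nat -> carK K E) (r : nat -> R),
    (forall k, (k < n)%nat -> 0 < r k < 1) -> sumR n r = 1 ->
    exists x : car E, is_inf E (fun h => exists th : nat -> R,
        (forall k, (k < n)%nat -> 0 < th k) /\
        prodR n (fun k => Rpower (th k) (r k)) = 1 /\
        h = sumE E n (fun k => scal (r k * th k) (reK K E (absK K E (f k))))) x.

Definition K_linear (K : KField) (A B : FAlg) (T : carK K A -> carK K B) : Prop :=
  (forall x y, T (addK K A x y) = addK K B (T x) (T y)) /\
  (forall (c : scalar K) x, T (scalK K A c x) = scalK K B c (T x)).

Definition positive_map (K : KField) (A B : FAlg) (T : carK K A -> carK K B) : Prop :=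
  forall a, posK K A a -> posK K B (T a).

(* Main.v *)
(* Writing [a^(1/p)] as an infimum of [t1 a / p + (1 - 1/p) t2] with
   [t1 = t2^(1-p)], the inequality in [B] follows from
   [T z^p <= l^(1-p) T x^p + (1-l)^(1-p) T y^p] for [z <= x + y] and [0 < l < 1]:
   the weights [t2 = a, b] of the two terms on the right are matched by
   [t2 = a + b] and [l = a / (a + b)] on the left.

   It remains to show that [x |-> x^p] is convex in [A].  Multiplication by a
   positive element preserves infima, which gives the tangent lines
   [x x^s >= (1+s) c^s x - s c^(1+s)] for [0 < s < 1]; conversely [z z^s] is the
   supremum of these tangents, since the excess over any other upper bound is at
   most [s c^(s-1) (z - c)^2] for every real [c > 0].  This makes [x^(1+s)] convex,
   and [(x - y) (x^q - y^q) >= 0] raises the exponent by one.  No step uses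
   commutativity of the product. *)

Require Import Defs.
From Stdlib Require Import Reals ZArith List Lra Lia ClassicalEpsilon.

Declare Scope falg_scope.
Delimit Scope falg_scope with FA.
Bind Scope falg_scope with car.
Arguments scal {_} _%_R _%_FA.
Notation "0" := zero : falg_scope.
Notation "1" := one : falg_scope.
Notation "x + y" := (add x y) : falg_scope.
Notation "- x" := (opp x) : falg_scope.
Notation "x - y" := (add x (opp y)) : falg_scope.
Notation "x * y" := (mul x y) : falg_scope.
Notation "x <= y" := (le x y) : falg_scope.
Notation "c *: x" := (scal c x) (at level 40, left associativity) : falg_scope.
Open Scope falg_scope.

(** * Linear arithmetic by reflection *)

Lemma addr0 {E : FAlg} (x : E) : x + 0 = x.
Proof. now rewrite addC, add0. Qed.

Lemma addrI {E : FAlg} (x y z : E) : x + y = x + z -> y = z.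
Proof.
  intros H. rewrite <- (add0 E y), <- (add0 E z), <- (addN E x), (addC E x).
  now rewrite <- !addA, H.
Qed.

Lemma scal0l {E : FAlg} (x : E) : 0 *: x = 0.
Proof.
  apply (addrI (0 *: x)). rewrite <- scalDl, addr0. f_equal. ring.
Qed.

Lemma scal0r {E : FAlg} (c : R) : c *: (0 : E) = 0.
Proof. apply (addrI (c *: 0)). now rewrite <- scalDr, !addr0. Qed.

Lemma oppE {E : FAlg} (x : E) : - x = (-1) *: x.
Proof.
  apply (addrI x). rewrite addN. rewrite <- (scal1 E x) at 1.
  rewrite <- scalDl. replace (1 + -1)%R with 0%R by ring. now rewrite scal0l.
Qed.

Lemma addACA {E : FAlg} (x y z t : E) : (x + y) + (z + t) = (x + z) + (y + t).
Proof. now rewrite !addA, <- (addA E x y z), (addC E y z), addA. Qed.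

Inductive lexp :=
  | LZero | LAtom (i : nat) | LAdd (a b : lexp) | LOpp (a : lexp)
  | LScal (c : R) (a : lexp).

Fixpoint lden {E : FAlg} (l : list E) (e : lexp) : E :=
  match e with
  | LZero => 0
  | LAtom i => nth i l 0
  | LAdd a b => lden l a + lden l b
  | LOpp a => - lden l a
  | LScal c a => c *: lden l a
  end.

Fixpoint lcoef (e : lexp) (j : nat) : R :=
  match e with
  | LZero => 0
  | LAtom i => if Nat.eqb i j then 1 else 0
  | LAdd a b => lcoef a j + lcoef b j
  | LOpp a => - lcoef a j
  | LScal c a => c * lcoef a j
  end.

Fixpoint lcomb {E : FAlg} (l : list E) (f : nat -> R) : E :=
  match l with
  | nil => 0
  | x :: l' => f O *: x + lcomb l' (fun i => f (S i))
  end.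

(** Recursion on [l] makes this unfold to one real equation per atom, which [ring] can close. *)
Fixpoint leqs {E : FAlg} (l : list E) (f g : nat -> R) : Prop :=
  match l with
  | nil => True
  | _ :: l' => f O = g O /\ leqs l' (fun i => f (S i)) (fun i => g (S i))
  end.

Lemma lcomb_eq {E : FAlg} (l : list E) (f g : nat -> R) :
  leqs l f g -> lcomb l f = lcomb l g.
Proof.
  revert f g; induction l as [|x l IH]; simpl; intros f g; [easy|].
  intros [H1 H2]. now rewrite H1, (IH _ _ H2).
Qed.

Lemma lcomb0 {E : FAlg} (l : list E) : lcomb l (fun _ => 0%R) = 0.
Proof. induction l as [|x l IH]; simpl; [easy|]. now rewrite IH, scal0l, add0. Qed.

Lemma lcombD {E : FAlg} (l : list E) (f g : nat -> R) :
  lcomb l f + lcomb l g = lcomb l (fun i => f i + g i)%R.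
Proof.
  revert f g; induction l as [|x l IH]; simpl; intros f g; [apply add0|].
  now rewrite <- IH, scalDl, addACA.
Qed.

Lemma lcombZ {E : FAlg} (l : list E) (c : R) (f : nat -> R) :
  c *: lcomb l f = lcomb l (fun i => c * f i)%R.
Proof.
  revert f; induction l as [|x l IH]; simpl; intros f; [apply scal0r|].
  now rewrite <- IH, scalDr, scalA.
Qed.

Lemma lcomb_atom {E : FAlg} (l : list E) (i : nat) :
  lcomb l (fun j => if Nat.eqb i j then 1 else 0)%R = nth i l 0.
Proof.
  revert i; induction l as [|x l IH]; intros [|i]; simpl; try easy.
  - now rewrite lcomb0, scal1, addr0.
  - now rewrite IH, scal0l, add0.
Qed.

Lemma leqs_opp {E : FAlg} (l : list E) (f : nat -> R) :
  leqs l (fun j => -1 * f j)%R (fun j => - f j)%R.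
Proof. revert f; induction l as [|x l IH]; simpl; intros f; [easy|]. split; [ring | apply IH]. Qed.

Lemma ldenE {E : FAlg} (l : list E) (e : lexp) : lden l e = lcomb l (lcoef e).
Proof.
  induction e as [|i|a IHa b IHb|a IHa|c a IHa]; cbn [lden].
  - symmetry; apply lcomb0.
  - symmetry; apply lcomb_atom.
  - rewrite IHa, IHb; apply lcombD.
  - rewrite IHa, oppE, lcombZ. apply lcomb_eq, leqs_opp.
  - rewrite IHa; apply lcombZ.
Qed.

Lemma lin_correct {E : FAlg} (l : list E) (e1 e2 : lexp) :
  leqs l (lcoef e1) (lcoef e2) -> lden l e1 = lden l e2.
Proof. intros H. now rewrite !ldenE, (lcomb_eq _ _ _ H). Qed.

Ltac lin_atoms t l :=
  lazymatch t with
  | zero => l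
  | add ?a ?b => let l1 := lin_atoms a l in lin_atoms b l1
  | opp ?a => lin_atoms a l
  | scal _ ?a => lin_atoms a l
  | _ =>
    let rec go m :=
      lazymatch m with
      | nil => constr:(t :: l)
      | t :: _ => l
      | _ :: ?m' => go m'
      end in go l
  end.

Ltac lin_reify t l :=
  lazymatch t with
  | zero => constr:(LZero)
  | add ?a ?b =>
      let u := lin_reify a l in let v := lin_reify b l in constr:(LAdd u v)
  | opp ?a => let u := lin_reify a l in constr:(LOpp u)
  | scal ?c ?a => let u := lin_reify a l in constr:(LScal c u)
  | _ =>
    let rec go m :=
      lazymatch m with
      | t :: _ => constr:(O)
      | _ :: ?m' => let i := go m' in constr:(S i)
      end in let i := go l in constr:(LAtom i)
  end.

(* Reduces an equation between linear combinations to the equality of the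
   coefficients of each atom. *)
Ltac lin_eq :=
  lazymatch goal with
  | |- @eq ?T ?x ?y =>
    let l := lin_atoms x (@nil T) in
    let l := lin_atoms y l in
    let e1 := lin_reify x l in
    let e2 := lin_reify y l in
    change (lden l e1 = lden l e2);
    apply lin_correct;
    cbv [leqs lcoef Nat.eqb]; repeat split
  end.
Ltac lin := lin_eq; try ring.

(** * Order and scalar multiplication *)

(** The equation says [y - x = b - a]. An inequality that is a linear rearrangement of [a <= b] thus
    becomes an identity for [lin]. *)
Lemma le_shift {E : FAlg} (a b x y : E) : a <= b -> y + a = x + b -> x <= y.
Proof.
  intros H He.
  assert (Hx : x = (a + (x - a))) by lin.
  assert (Hy : y = (b + (x - a))).
  { apply (addrI a). rewrite (addC E a y), He. lin. }
  rewrite Hx, Hy. now apply le_add.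
Qed.

Tactic Notation "le_by" constr(H) := apply (le_shift _ _ _ _ H); lin.

Lemma le_addm {E : FAlg} (a b c d : E) : a <= b -> c <= d -> a + c <= b + d.
Proof.
  intros H1 H2. apply (le_trans E _ (b + c)); [now apply le_add|].
  rewrite (addC E b c), (addC E b d). now apply le_add.
Qed.

Lemma le_0sub {E : FAlg} (x y : E) : x <= y -> 0 <= y - x.
Proof. intros H. le_by H. Qed.

Lemma le_sub0 {E : FAlg} (x y : E) : 0 <= y - x -> x <= y.
Proof. intros H. le_by H. Qed.

Lemma add_pos {E : FAlg} (x y : E) : 0 <= x -> 0 <= y -> 0 <= x + y.
Proof. intros H1 H2. rewrite <- (add0 E 0). now apply le_addm. Qed.

Lemma scal_pos {E : FAlg} (c : R) (x : E) : (0 <= c)%R -> 0 <= x -> 0 <= c *: x.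
Proof. intros Hc Hx. rewrite <- (scal0r c). now apply le_scal. Qed.

Lemma le_scal_l {E : FAlg} (c d : R) (x : E) :
  (c <= d)%R -> 0 <= x -> c *: x <= d *: x.
Proof.
  intros Hc Hx. assert (H : 0 <= (d - c) *: x) by (apply scal_pos; [lra|easy]).
  le_by H.
Qed.

Lemma le_scal_inv {E : FAlg} (c : R) (x y : E) :
  (0 < c)%R -> c *: x <= c *: y -> x <= y.
Proof.
  intros Hc H. apply (le_scal E (/ c)) in H.
  - rewrite !scalA, Rinv_l, !scal1 in H; [easy|lra].
  - now left; apply Rinv_0_lt_compat.
Qed.

(** * Positive parts and products *)

Definition ppart {E : FAlg} (x : E) : E := join x 0.

Lemma ppart_pos {E : FAlg} (x : E) : 0 <= ppart x.
Proof. apply join_ubr. Qed.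

Lemma ppart_ge {E : FAlg} (x : E) : x <= ppart x.
Proof. apply join_ubl. Qed.

Lemma ppart_lub {E : FAlg} (x y : E) : x <= y -> 0 <= y -> ppart x <= y.
Proof. apply join_lub. Qed.

Lemma joinC {E : FAlg} (x y : E) : join x y = join y x.
Proof. apply le_anti; apply join_lub; (apply join_ubl || apply join_ubr). Qed.

Lemma joinD {E : FAlg} (x y z : E) : join (x + z) (y + z) = join x y + z.
Proof.
  apply le_anti.
  - apply join_lub; apply le_add; [apply join_ubl | apply join_ubr].
  - assert (H : join x y <= join (x + z) (y + z) - z).
    { apply join_lub.
      - assert (H := join_ubl E (x + z) (y + z)). le_by H.
      - assert (H := join_ubr E (x + z) (y + z)). le_by H. }
    le_by H.
Qed.

Lemma ppart_sub {E : FAlg} (x : E) : ppart x - ppart (- x) = x.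
Proof.
  unfold ppart. assert (H := joinD (- x) 0 x).
  replace (- x + x) with (0 : E) in H by lin. rewrite add0, joinC in H.
  rewrite H. lin.
Qed.

(** Both arguments of the join are translates by [- ppart x], one of [0] and one of [x], so the join
    is [ppart x - ppart x]. *)
Lemma ppart_disj {E : FAlg} (x : E) :
  - join (- ppart x) (- ppart (- x)) = 0.
Proof.
  replace (- ppart (- x)) with (x - ppart x)
    by (rewrite <- (ppart_sub x) at 1; lin).
  rewrite <- (add0 E (- ppart x)) at 1. rewrite joinD, joinC.
  change (join x 0) with (ppart x). lin.
Qed.

Lemma disj_sym {E : FAlg} (x y : E) :
  - join (- x) (- y) = 0 -> - join (- y) (- x) = 0.
Proof. now rewrite joinC. Qed.

(** The f-algebra property, applied once on each side, makes [x * y] disjoint from [x] and then from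
    itself. *)
Lemma disj_mul {E : FAlg} (x y : E) :
  0 <= x -> 0 <= y -> - join (- x) (- y) = 0 -> x * y = 0.
Proof.
  intros Hx Hy H.
  assert (H1 := f_prop_l E y x x (disj_sym _ _ H) Hx).
  assert (H2 := f_prop_r E x (x * y) y (disj_sym _ _ H1) Hy).
  assert (H3 : join (- (x * y)) (- (x * y)) = - (x * y)).
  { apply le_anti; [apply join_lub; apply le_refl | apply join_ubl]. }
  rewrite H3 in H2. rewrite <- H2. lin.
Qed.

Lemma mul0l {E : FAlg} (x : E) : 0 * x = 0.
Proof. rewrite <- (scal0l (0 : E)) at 1. rewrite mulZl. apply scal0l. Qed.

Lemma mul0r {E : FAlg} (x : E) : x * 0 = 0.
Proof. rewrite <- (scal0l (0 : E)) at 1. rewrite mulZr. apply scal0l. Qed.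

Lemma mulNl {E : FAlg} (x y : E) : (- x) * y = - (x * y).
Proof. rewrite !oppE. apply mulZl. Qed.

Lemma mulNr {E : FAlg} (x y : E) : x * (- y) = - (x * y).
Proof. rewrite !oppE. apply mulZr. Qed.

Ltac expand :=
  repeat (rewrite mulDl || rewrite mulDr || rewrite mulZl || rewrite mulZr
    || rewrite mulNl || rewrite mulNr || rewrite mul1l || rewrite mul1r
    || rewrite mulA || rewrite mul0l || rewrite mul0r).

Lemma le_mul_l {E : FAlg} (u x y : E) : 0 <= u -> x <= y -> u * x <= u * y.
Proof.
  intros Hu H. apply le_sub0. rewrite <- mulNr, <- mulDr.
  apply mul_pos; [easy | now apply le_0sub].
Qed.

Lemma le_mul_r {E : FAlg} (u x y : E) : 0 <= u -> x <= y -> x * u <= y * u.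
Proof.
  intros Hu H. apply le_sub0. rewrite <- mulNl, <- mulDl.
  apply mul_pos; [now apply le_0sub | easy].
Qed.

Lemma ppart_mul_npart {E : FAlg} (x : E) : ppart x * ppart (- x) = 0.
Proof. apply disj_mul; try apply ppart_pos. apply ppart_disj. Qed.

Lemma npart_mul_ppart {E : FAlg} (x : E) : ppart (- x) * ppart x = 0.
Proof. apply disj_mul; try apply ppart_pos. apply disj_sym, ppart_disj. Qed.

Lemma ppart_mul {E : FAlg} (x : E) : ppart x * x = ppart x * ppart x.
Proof.
  rewrite <- (ppart_sub x) at 2. rewrite mulDr, mulNr, ppart_mul_npart. lin.
Qed.

Lemma mul_ppart {E : FAlg} (x : E) : x * ppart x = ppart x * ppart x.
Proof.
  rewrite <- (ppart_sub x) at 1. rewrite mulDl, mulNl, npart_mul_ppart. lin.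
Qed.

Lemma ppart_mul_pos {E : FAlg} (x : E) : 0 <= ppart x * x.
Proof. rewrite ppart_mul. apply mul_pos; apply ppart_pos. Qed.

Lemma sqr_pos {E : FAlg} (x : E) : 0 <= x * x.
Proof.
  replace (x * x) with (ppart x * ppart x + ppart (- x) * ppart (- x)).
  - apply add_pos; apply mul_pos; apply ppart_pos.
  - rewrite <- (ppart_sub x) at 5 6.
    expand. rewrite ppart_mul_npart, npart_mul_ppart. lin.
Qed.

Lemma one_pos {E : FAlg} : 0 <= (1 : E).
Proof. rewrite <- (mul1l E 1). apply sqr_pos. Qed.

(** * Archimedean arguments *)

Lemma archi_le {E : FAlg} (x y : E) :
  (forall n : nat, (0 < n)%nat -> INR n *: x <= y) -> x <= 0.
Proof.
  (* [archi] asks for a nonnegative element, so it is applied to [ppart x], whose multiples are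
     bounded by [ppart y]. *)
  intros H. assert (Hp : ppart x = 0).
  { apply (archi E _ (ppart y) (ppart_pos x)). intros [|n].
    - simpl. rewrite scal0l. apply ppart_pos.
    - assert (Hn : (0 < INR (S n))%R) by (apply lt_0_INR; lia).
      apply (le_scal_inv (/ INR (S n))); [now apply Rinv_0_lt_compat|].
      rewrite scalA, Rinv_l, scal1 by lra.
      apply ppart_lub.
      + apply (le_scal_inv (INR (S n))); [easy|].
        rewrite scalA, Rinv_r, scal1 by lra.
        apply (le_trans E _ y); [apply H; lia | apply ppart_ge].
      + apply scal_pos; [now left; apply Rinv_0_lt_compat | apply ppart_pos]. }
  rewrite <- Hp. apply ppart_ge.
Qed.

Lemma archi_eps {E : FAlg} (x y : E) :
  (forall eps, (0 < eps <= 1)%R -> x <= eps *: y) -> x <= 0.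
Proof.
  intros H. apply (archi_le x y). intros n Hn.
  assert (Hn1 : (1 <= INR n)%R) by (apply (le_INR 1); lia).
  apply (le_scal_inv (/ INR n)); [apply Rinv_0_lt_compat; lra|].
  rewrite scalA, Rinv_l, scal1 by lra. apply H. split.
  - apply Rinv_0_lt_compat; lra.
  - rewrite <- Rinv_1. apply Rinv_le_contravar; lra.
Qed.

(* Multiplying by the bounded element (n - u)^+ truncates u. *)
Lemma mul_inf_glb {E : FAlg} (S : E -> Prop) (k u g : E) :
  is_inf E S k -> 0 <= u -> (forall h, S h -> g <= u * h) -> g <= u * k.
Proof.
  intros [Hlb Hglb] Hu H. set (v := ppart (g - u * k)).
  assert (Hv : 0 <= v) by apply ppart_pos.
  assert (Hvh : forall h, S h -> v <= u * (h - k)).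
  { intros h Hh. apply ppart_lub.
    - rewrite mulDr, mulNr. apply le_add. now apply H.
    - apply mul_pos; [easy|]. apply le_0sub. now apply Hlb. }
  assert (Hv0 : v <= 0).
  { apply (archi_le v (u * v)). intros n Hn.
    assert (Hn1 : (0 < INR n)%R) by (apply lt_0_INR; lia).
    set (d := INR n *: 1 - u). set (w := ppart d).
    assert (Hw : 0 <= w) by apply ppart_pos.
    assert (Hwn : w <= INR n *: 1).
    { apply ppart_lub; [unfold d; le_by Hu | apply scal_pos; [lra | apply one_pos]]. }
    assert (Hwu : w * u <= (INR n * INR n) *: 1).
    { assert (H1 := ppart_mul_pos d). fold w in H1. unfold d in H1.
      rewrite mulDr, mulZr, mulNr, mul1r in H1.
      apply (le_trans E _ (INR n *: w)); [le_by H1|].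
      rewrite <- scalA. apply le_scal; [lra|easy]. }
    (* The bound on [w * u] turns [w v <= w u (h - k)] into [w v <= n^2 (h - k)], so [k + n^-2 w v]
       is still a lower bound of [S]. *)
    assert (Hwv : w * v <= 0).
    { assert (H1 : k + / (INR n * INR n) *: (w * v) <= k).
      { apply Hglb. intros h Hh.
        assert (H1 : w * v <= (INR n * INR n) *: (h - k)).
        { apply (le_trans E _ (w * (u * (h - k)))).
          - apply le_mul_l; [easy | now apply Hvh].
          - rewrite mulA. rewrite <- (mul1l E (h - k)) at 2. rewrite <- mulZl.
            apply le_mul_r; [|easy]. apply le_0sub. now apply Hlb. }
        apply (le_scal E (/ (INR n * INR n))) in H1.
        - rewrite scalA, Rinv_l, scal1 in H1 by nra. le_by H1.
        - left; apply Rinv_0_lt_compat; nra. }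
      apply (le_scal_inv (/ (INR n * INR n))).
      - apply Rinv_0_lt_compat; nra.
      - rewrite scal0r. le_by H1. }
    (* As [d <= w], this yields [(n - u) v <= 0], that is [n v <= u v]. *)
    assert (H1 : d * v <= w * v) by (apply le_mul_r; [easy | apply ppart_ge]).
    unfold d in H1. rewrite mulDl, mulZl, mulNl, mul1l in H1.
    assert (H2 := le_trans E _ _ _ H1 Hwv). le_by H2. }
  assert (H1 := le_trans E _ _ _ (ppart_ge (g - u * k)) Hv0). le_by H1.
Qed.
(** * Fractional powers *)

Definition gm_set {E : FAlg} (a : E) (s : R) : E -> Prop :=
  fun h => exists t1 t2 : R, (0 < t1)%R /\ (0 < t2)%R /\
    (Rpower t1 s * Rpower t2 (1 - s) = 1)%R /\
    h = (s * t1) *: a + ((1 - s) * t2) *: 1.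

(** Existence of the weighted geometric means of [a] and [1], phrased on the real algebra so that
    the analysis does not depend on the scalar field. *)
Definition frac_closed (E : FAlg) : Prop :=
  forall (a : E) (s : R), 0 <= a -> (0 < s < 1)%R ->
    exists x, is_inf E (gm_set a s) x.

Lemma gm_weights_ln (s t1 t2 : R) :
  (Rpower t1 s * Rpower t2 (1 - s) = 1 <-> s * ln t1 + (1 - s) * ln t2 = 0)%R.
Proof.
  unfold Rpower. rewrite <- exp_plus. split; intros H.
  - apply exp_inv. now rewrite H, exp_0.
  - now rewrite H, exp_0.
Qed.

Lemma fracpow_inf {E : FAlg} (fc : frac_closed E) (a : E) (s : R) :
  0 <= a -> (0 < s < 1)%R -> is_inf E (gm_set a s) (fracpow E a s).
Proof.
  intros Ha Hs. unfold fracpow. destruct (Req_EM_T s 0) as [H|_]; [lra|].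
  unfold infE. apply (epsilon_spec (inhabits 0) (is_inf E (gm_set a s))).
  now apply fc.
Qed.

Lemma fracpow0 {E : FAlg} (a : E) : fracpow E a 0 = 1.
Proof. unfold fracpow. destruct (Req_EM_T 0 0); [easy|lra]. Qed.

Lemma fracpow_lb {E : FAlg} (fc : frac_closed E) (a : E) (s t1 t2 : R) :
  0 <= a -> (0 < s < 1)%R -> (0 < t1)%R -> (0 < t2)%R ->
  (s * ln t1 + (1 - s) * ln t2 = 0)%R ->
  fracpow E a s <= (s * t1) *: a + ((1 - s) * t2) *: 1.
Proof.
  intros Ha Hs H1 H2 H. apply (fracpow_inf fc a s Ha Hs).
  exists t1, t2. rewrite gm_weights_ln. auto.
Qed.

Lemma mul_fracpow_glb {E : FAlg} (fc : frac_closed E) (u g a : E) (s : R) :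
  0 <= a -> 0 <= u -> (0 < s < 1)%R ->
  (forall t1 t2, (0 < t1)%R -> (0 < t2)%R ->
    (s * ln t1 + (1 - s) * ln t2 = 0)%R ->
    g <= u * ((s * t1) *: a + ((1 - s) * t2) *: 1)) ->
  g <= u * fracpow E a s.
Proof.
  intros Ha Hu Hs H. apply (mul_inf_glb (gm_set a s)).
  - now apply fracpow_inf.
  - easy.
  - intros h (t1 & t2 & H1 & H2 & H3 & ->). apply gm_weights_ln in H3. auto.
Qed.

Lemma fracpow_glb {E : FAlg} (fc : frac_closed E) (g a : E) (s : R) :
  0 <= a -> (0 < s < 1)%R ->
  (forall t1 t2, (0 < t1)%R -> (0 < t2)%R ->
    (s * ln t1 + (1 - s) * ln t2 = 0)%R ->
    g <= (s * t1) *: a + ((1 - s) * t2) *: 1) ->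
  g <= fracpow E a s.
Proof.
  intros Ha Hs H. rewrite <- (mul1l E (fracpow E a s)).
  apply mul_fracpow_glb; [easy | easy | apply one_pos | easy |].
  intros t1 t2 H1 H2 H3. rewrite mul1l. auto.
Qed.

Lemma fracpow_pos {E : FAlg} (fc : frac_closed E) (a : E) (s : R) :
  0 <= a -> (0 <= s < 1)%R -> 0 <= fracpow E a s.
Proof.
  intros Ha Hs. destruct (Req_dec s 0) as [->|Hs0].
  - rewrite fracpow0. apply one_pos.
  - apply fracpow_glb; [easy | easy | lra |]. intros t1 t2 H1 H2 _.
    apply add_pos; apply scal_pos; try easy; try nra. apply one_pos.
Qed.

(** * Tangent lines of [x * x ^ s] *)

(** With [l] the mean of the logarithms, the tangent of [exp] at [l] gives
    [exp l * (1 + (ln x - l)) <= x]; averaging over [a] and [b] cancels the linear terms. *)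
Lemma amgm (r a b : R) : (0 <= r <= 1 -> 0 < a -> 0 < b ->
  exp (r * ln a + (1 - r) * ln b) <= r * a + (1 - r) * b)%R.
Proof.
  intros Hr Ha Hb. set (l := (r * ln a + (1 - r) * ln b)%R).
  assert (Hg : (0 < exp l)%R) by apply exp_pos.
  assert (H : forall x, (0 < x -> exp l * (1 + (ln x - l)) <= x)%R).
  { intros x Hx. rewrite <- (exp_ln x Hx) at 2.
    replace (ln x) with (l + (ln x - l))%R at 2 by ring. rewrite exp_plus.
    apply Rmult_le_compat_l; [lra | apply exp_ineq1_le]. }
  assert (H1 := Rmult_le_compat_l r _ _ (proj1 Hr) (H a Ha)).
  assert (H2 := Rmult_le_compat_l (1 - r) _ _ ltac:(lra) (H b Hb)).
  apply Rle_trans with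
    (r * (exp l * (1 + (ln a - l))) + (1 - r) * (exp l * (1 + (ln b - l))))%R;
    [|lra].
  right. transitivity (exp l * (1 + (r * ln a + (1 - r) * ln b) - l))%R; [|ring].
  unfold l. ring.
Qed.

(** Weighted AM-GM for [t2] and [b = t1^(1/2) c^((1+s)/2)] with weights [(1-s)/(1+s)] and
    [2s/(1+s)]. The constraint on [t1], [t2] reduces the geometric mean to [c^s]. *)
Lemma tangent_weights (s t1 t2 c : R) : (0 < s < 1 -> 0 < t1 -> 0 < t2 -> 0 < c ->
  s * ln t1 + (1 - s) * ln t2 = 0 ->
  (1 + s) * Rpower c s <=
    (1 - s) * t2 + 2 * s * (exp (ln t1 / 2) * exp ((1 + s) / 2 * ln c)))%R.
Proof.
  intros Hs H1 H2 Hc H. rewrite <- exp_plus.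
  set (b := exp (ln t1 / 2 + (1 + s) / 2 * ln c)).
  assert (Hr : (0 <= (1 - s) / (1 + s) <= 1)%R).
  { split; [apply Rmult_le_pos; [lra | left; apply Rinv_0_lt_compat; lra]|].
    apply (Rmult_le_reg_r (1 + s)); [lra|]. field_simplify; lra. }
  assert (HA := amgm _ t2 b Hr H2 ltac:(apply exp_pos)).
  unfold b in HA at 1. rewrite ln_exp in HA.
  replace ((1 - s) / (1 + s) * ln t2 +
    (1 - (1 - s) / (1 + s)) * (ln t1 / 2 + (1 + s) / 2 * ln c))%R
    with (s * ln c)%R in HA.
  - apply (Rmult_le_compat_l (1 + s)) in HA; [|lra].
    unfold Rpower. eapply Rle_trans; [exact HA|]. right. field; lra.
  - transitivity ((s * ln t1 + (1 - s) * ln t2) / (1 + s) + s * ln c)%R.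
    + rewrite H. field; lra.
    + field; lra.
Qed.

(** Each member of the infimum, multiplied by [x], is [s t1 x^2 + (1-s) t2 x]. The square of
    [a x - b], with [a^2 = t1] and [b^2 = c^(1+s)], bounds [t1 x^2] below by [2 a b x - b^2], and
    [tangent_weights] bounds the resulting coefficient of [x]. *)
Lemma mul_fracpow_tangent {E : FAlg} (fc : frac_closed E) (x : E) (s c : R) :
  0 <= x -> (0 < s < 1)%R -> (0 < c)%R ->
  ((1 + s) * Rpower c s) *: x - (s * (c * Rpower c s)) *: 1 <= x * fracpow E x s.
Proof.
  intros Hx Hs Hc. apply mul_fracpow_glb; [easy | easy | easy | easy |].
  intros t1 t2 H1 H2 H.
  assert (HW := tangent_weights s t1 t2 c Hs H1 H2 Hc H).
  set (a := exp (ln t1 / 2)) in *. set (b := exp ((1 + s) / 2 * ln c)) in *.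
  assert (Haa : (a * a = t1)%R).
  { unfold a. rewrite <- exp_plus. replace (ln t1 / 2 + ln t1 / 2)%R with (ln t1) by field.
    now apply exp_ln. }
  assert (Hbb : (b * b = c * Rpower c s)%R).
  { unfold b, Rpower. rewrite <- exp_plus. rewrite <- (exp_ln c Hc) at 3.
    rewrite <- exp_plus. f_equal. field. }
  assert (Hsq := sqr_pos (a *: x - b *: 1)).
  apply (le_scal E s) in Hsq; [|lra].
  apply (le_scal_l _ _ x) in HW; [|easy].
  assert (HH := le_addm _ _ _ _ Hsq HW).
  revert HH. rewrite <- Hbb, <- Haa. expand. intros HH. le_by HH.
Qed.

(** * Convexity of [x * x ^ s] *)

(** Localized to the band of [v]: [y^2 >= b^2] and [y >= -a > -b] leave only [y >= b]. The proof
    shows that [r], the positive part of [b - y], satisfies [v r <= 0]. *)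
Lemma mul_sqr_gap {E : FAlg} (v y : E) (a b : R) :
  0 <= v -> (0 <= a < b)%R -> (b * b) *: v <= v * (y * y) ->
  (- a) *: v <= v * y -> b *: v <= v * y.
Proof.
  intros Hv Hab Hyy Hy. set (d := y - b *: 1). set (r := ppart (- d)).
  assert (Hr : 0 <= r) by apply ppart_pos.
  assert (Hdr : d * r = - (r * r)).
  { assert (H := mul_ppart (- d)). fold r in H. rewrite mulNl in H.
    rewrite <- H. lin. }
  assert (Hyr : y * r = b *: r - r * r).
  { assert (H := Hdr). unfold d in H. rewrite mulDl, mulNl, mulZl, mul1l in H.
    apply (addrI (- (b *: r))). rewrite addC, H. lin. }
  (* [v (y - b) (y + b) >= 0] and [(y - b) r = - r^2] *)
  assert (Hvrr : v * (r * r) <= 0).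
  { apply (le_scal_inv (b - a)); [lra|]. rewrite scal0r.
    assert (H1 := le_mul_r (r * r) _ _ (sqr_pos r) Hy).
    assert (H2 := le_mul_r r _ _ Hr Hyy).
    rewrite mulZl in H1, H2. rewrite <- !mulA in H1, H2.
    rewrite <- (mulA E y y r), Hyr in H2.
    replace (y * (b *: r - r * r)) with (b *: (b *: r - r * r) - y * (r * r)) in H2.
    2:{ rewrite mulDr, mulZr, mulNr, Hyr. lin. }
    rewrite !mulDr, !mulNr, !mulZr, !mulDr, !mulNr, !mulZr in H2.
    assert (H3 := le_addm _ _ _ _ H1 H2). le_by H3. }
  assert (Hvr : v * r <= 0).
  (* Expanding [v (n r - 1)^2 >= 0] and using [v r^2 <= 0] gives [2 n v r <= v], hence [n v r <= v]
     for every [n]. *)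
  { apply (archi_le _ v). intros n Hn.
    assert (Hn1 : (1 <= INR n)%R) by (apply (le_INR 1); lia).
    assert (H1 := le_mul_l v _ _ Hv (sqr_pos (INR n *: r - 1))).
    assert (H2 := le_scal E (INR n * INR n) _ _ ltac:(nra) Hvrr).
    assert (H3 := scal_pos (INR n) _ ltac:(lra) (mul_pos E v r Hv Hr)).
    assert (H4 := le_addm _ _ _ _ H3 (le_addm _ _ _ _ H1 H2)).
    revert H4. expand. intros H4. le_by H4. }
  assert (Hd : 0 <= v * ppart d) by (apply mul_pos; [easy | apply ppart_pos]).
  assert (H : ppart d = d + r) by (rewrite <- (ppart_sub d) at 2; unfold r; lin).
  rewrite H in Hd. unfold d in Hd. rewrite !mulDr, mulNr, mulZr, mul1r in Hd.
  assert (H1 := le_addm _ _ _ _ Hd Hvr). le_by H1.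
Qed.

(* On the band where [u > 4 K c0^2], [z] has distance at least [2 c0] from every
   [c >= c0]; as [z >= 0], steps of length [c0] then show that [z] exceeds every
   multiple of [c0] there. *)
Lemma le_sqr_dist {E : FAlg} (z u : E) (K c0 : R) :
  0 <= z -> (0 < K)%R -> (0 < c0)%R ->
  (forall c, (c0 <= c)%R -> u <= K *: ((z - c *: 1) * (z - c *: 1))) ->
  u <= (4 * K * (c0 * c0)) *: 1.
Proof.
  intros Hz HK Hc0 H. set (eps := (4 * K * (c0 * c0))%R).
  set (v := ppart (u - eps *: 1)).
  assert (Hv : 0 <= v) by apply ppart_pos.
  assert (Hgap : forall c, (c0 <= c)%R ->
    (2 * c0 * (2 * c0)) *: v <= v * ((z - c *: 1) * (z - c *: 1))).
  { intros c Hc. apply (le_scal_inv K); [easy|]. rewrite <- mulZr.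
    apply (le_trans E _ (v * u)).
    - assert (H1 := ppart_mul_pos (u - eps *: 1)). fold v in H1.
      rewrite mulDr, mulNr, mulZr, mul1r in H1. unfold eps in H1. le_by H1.
    - apply le_mul_l; [easy | now apply H]. }
  assert (Hstep : forall n : nat, 0 <= v * (z - (INR n * c0) *: 1)).
  { induction n as [|n IH].
    - simpl. replace (z - (0 * c0) *: 1) with z by lin. now apply mul_pos.
    - assert (Hn : (0 <= INR n)%R) by apply pos_INR.
      rewrite S_INR. set (c := ((INR n + 1) * c0)%R).
      apply (le_trans E _ ((2 * c0) *: v)); [apply scal_pos; [lra|easy]|].
      apply (mul_sqr_gap v _ c0); [easy | lra | apply Hgap; unfold c; nra |].
      revert IH. expand. unfold c. intros IH. le_by IH. }
  assert (Hv0 : v <= 0).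
  { apply (archi_le v ((/ c0) *: (v * z))). intros n _.
    apply (le_scal_inv c0); [easy|]. rewrite !scalA, Rinv_r, scal1 by lra.
    assert (H1 := Hstep n). revert H1. expand. intros H1. le_by H1. }
  assert (H1 := le_trans E _ _ _ (ppart_ge (u - eps *: 1)) Hv0). le_by H1.
Qed.

Lemma Rpower_le1 (c s : R) : (0 < c <= 1 -> 0 <= s -> Rpower c s <= 1)%R.
Proof.
  intros Hc Hs. unfold Rpower. rewrite <- exp_0.
  assert (H : (ln c <= 0)%R).
  { rewrite <- ln_1. destruct (Req_dec c 1) as [->|Hn]; [lra|].
    left. apply ln_increasing; lra. }
  assert (H1 : (s * ln c <= 0)%R) by nra.
  destruct H1 as [H1| ->]; [left; now apply exp_increasing | lra].
Qed.

Lemma mul_fracpow_le {E : FAlg} (fc : frac_closed E) (z w : E) (s : R) :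
  0 <= z -> (0 < s < 1)%R ->
  (forall c, (0 < c)%R ->
    ((1 + s) * Rpower c s) *: z - (s * (c * Rpower c s)) *: 1 <= w) ->
  z * fracpow E z s <= w.
Proof.
  intros Hz Hs Hw.
  assert (H : forall c, (0 < c)%R -> z * fracpow E z s - w <=
    (s * Rpower c (s - 1)) *: ((z - c *: 1) * (z - c *: 1))).
  { intros c Hc.
    (* The weights [t1 = c^(s-1)] and [t2 = c^s] are those for which the upper bound touches the
       tangent at [c]; their difference is [s c^(s-1) (z - c)^2]. *)
    assert (H1 := fracpow_lb fc z s (Rpower c (s - 1)) (Rpower c s) Hz Hs
      ltac:(apply exp_pos) ltac:(apply exp_pos)
      ltac:(unfold Rpower; rewrite !ln_exp; ring)).
    apply (le_mul_l z) in H1; [|easy].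
    assert (H2 := le_addm _ _ _ _ H1 (Hw c Hc)). revert H2.
    assert (Hcs : (Rpower c s = c * Rpower c (s - 1))%R).
    { rewrite <- (Rpower_1 c Hc) at 2. rewrite <- Rpower_plus. f_equal. ring. }
    rewrite Hcs. expand. intros H2. le_by H2. }
  assert (H0 : z * fracpow E z s - w <= 0).
  { apply (archi_eps _ (4 *: 1)). intros c0 Hc0.
    assert (Hp : (0 < Rpower c0 (s - 1))%R) by apply exp_pos.
    (* Since [s < 1], [c^(s-1)] decreases in [c], so its value at [c0] serves for all [c >= c0]. *)
    assert (Hd : forall c, (c0 <= c)%R -> z * fracpow E z s - w <=
      (s * Rpower c0 (s - 1)) *: ((z - c *: 1) * (z - c *: 1))).
    { intros c Hc. eapply le_trans; [apply (H c); lra|].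
      apply le_scal_l; [|apply sqr_pos].
      apply Rmult_le_compat_l; [lra|]. unfold Rpower.
      assert (Hl : (ln c0 <= ln c)%R).
      { destruct Hc as [Hc| ->]; [left; apply ln_increasing; lra | lra]. }
      destruct Hl as [Hl| ->]; [|lra].
      left. apply exp_increasing. nra. }
    (* The bound obtained is [4 s c0^(s-1) c0^2 = 4 s c0 c0^s], at most [4 c0] because [c0 <= 1]. *)
    eapply le_trans; [apply (le_sqr_dist z _ _ c0 Hz) in Hd; [exact Hd | nra | lra]|].
    rewrite scalA. apply le_scal_l; [|apply one_pos].
    assert (H1 : (Rpower c0 s = c0 * Rpower c0 (s - 1))%R).
    { rewrite <- (Rpower_1 c0) at 2 by lra. rewrite <- Rpower_plus. f_equal. ring. }
    assert (H2 := Rpower_le1 c0 s ltac:(lra) ltac:(lra)).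
    replace (4 * (s * Rpower c0 (s - 1)) * (c0 * c0))%R
      with (4 * s * c0 * Rpower c0 s)%R by (rewrite H1; ring).
    assert (H3 : (0 < Rpower c0 s)%R) by apply exp_pos.
    assert (H4 : (s * Rpower c0 s <= 1)%R) by nra. nra. }
  le_by H0.
Qed.

(** For each [c] the tangent bounds at [x] and [y] average to the one at [l x + m y], and
    [mul_fracpow_le] needs only these. *)
Lemma mul_fracpow_convex {E : FAlg} (fc : frac_closed E) (x y : E) (s l m : R) :
  0 <= x -> 0 <= y -> (0 <= s < 1)%R -> (0 <= l)%R -> (0 <= m)%R -> (l + m = 1)%R ->
  (l *: x + m *: y) * fracpow E (l *: x + m *: y) s <=
    l *: (x * fracpow E x s) + m *: (y * fracpow E y s).
Proof.
  intros Hx Hy Hs Hl Hm Hlm. destruct (Req_dec s 0) as [->|Hs0].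
  - rewrite !fracpow0, !mul1r. apply le_refl.
  - assert (Hs1 : (0 < s < 1)%R) by lra.
    apply mul_fracpow_le; [easy | now apply add_pos; apply scal_pos | easy |].
    intros c Hc.
    assert (H1 := le_scal E l _ _ Hl (mul_fracpow_tangent fc x s c Hx Hs1 Hc)).
    assert (H2 := le_scal E m _ _ Hm (mul_fracpow_tangent fc y s c Hy Hs1 Hc)).
    assert (H3 := le_addm _ _ _ _ H1 H2).
    assert (Hm' : m = (1 - l)%R) by lra. subst m. le_by H3.
Qed.
(** * Powers with exponent larger than one *)

Lemma npow_pos {E : FAlg} (x : E) (m : nat) : 0 <= x -> 0 <= npow E x m.
Proof.
  intros Hx. induction m as [|m IH]; simpl; [apply one_pos | now apply mul_pos].
Qed.

Lemma npowSr {E : FAlg} (x : E) (m : nat) : npow E x (S m) = npow E x m * x.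
Proof.
  induction m as [|m IH]; [simpl; now rewrite mul1l, mul1r|].
  change (x * npow E x (S m) = x * npow E x m * x). now rewrite IH, mulA.
Qed.

(** The factor [d] passes into the infimum for [x], whose members are affine in [x] with nonnegative
    slope, so a comparison of [y] and [x] after multiplication by [d] suffices. *)
Lemma mul_fracpow_mono {E : FAlg} (fc : frac_closed E) (d x y : E) (s : R) :
  0 <= d -> 0 <= x -> 0 <= y -> (0 <= s < 1)%R -> d * y <= d * x ->
  d * fracpow E y s <= d * fracpow E x s.
Proof.
  intros Hd Hx Hy Hs H. destruct (Req_dec s 0) as [->|Hs0].
  - rewrite !fracpow0. apply le_refl.
  - apply mul_fracpow_glb; [easy | easy | easy | lra |].
    intros t1 t2 H1 H2 H3.
    eapply le_trans.
    + apply le_mul_l; [easy|]. apply (fracpow_lb fc y s t1 t2); try easy; lra.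
    + rewrite !mulDr, !mulZr. apply le_add. apply le_scal; [nra|easy].
Qed.

(** By the f-algebra property a positive factor [c] keeps the two parts of [x - y] disjoint, so only
    the product with the positive part survives. This replaces commuting [c] past [x - y]. *)
Lemma ppart_mul_mono {E : FAlg} (x y c : E) :
  0 <= c -> ppart (x - y) * c * y <= ppart (x - y) * c * x.
Proof.
  intros Hc. apply le_sub0. rewrite <- mulNr, <- mulDr.
  set (d := x - y). rewrite <- (ppart_sub d) at 2. rewrite mulDr, mulNr.
  assert (H0 : ppart d * c * ppart (- d) = 0).
  { apply disj_mul; [apply mul_pos; [apply ppart_pos|easy] | apply ppart_pos |].
    apply f_prop_r; [apply ppart_disj | easy]. }
  assert (H1 : 0 <= ppart d * c * ppart d)
    by (repeat apply mul_pos; try apply ppart_pos; easy).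
  rewrite H0. le_by H1.
Qed.

(** New factors are split off on the right, which leaves [ppart (x - y)] leftmost: first the power
    changes by induction, then the last factor. *)
Lemma ppart_mul_npow_mono {E : FAlg} (x y : E) (m : nat) : 0 <= x -> 0 <= y ->
  ppart (x - y) * npow E y m <= ppart (x - y) * npow E x m.
Proof.
  intros Hx Hy. induction m as [|m IH]; [apply le_refl|].
  rewrite !npowSr, !mulA. eapply le_trans.
  - apply le_mul_r; [easy | exact IH].
  - apply ppart_mul_mono. now apply npow_pos.
Qed.

Lemma ppart_mul_pow_mono {E : FAlg} (fc : frac_closed E) (x y : E) (m : nat) (s : R) :
  0 <= x -> 0 <= y -> (0 <= s < 1)%R ->
  ppart (x - y) * (npow E y m * fracpow E y s) <=
  ppart (x - y) * (npow E x m * fracpow E x s).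
Proof.
  intros Hx Hy Hs. rewrite !mulA. eapply le_trans.
  - apply le_mul_r; [now apply fracpow_pos | now apply ppart_mul_npow_mono].
  - apply mul_fracpow_mono; try easy.
    + apply mul_pos; [apply ppart_pos | now apply npow_pos].
    + apply ppart_mul_mono. now apply npow_pos.
Qed.

(** Split [x - y] into its positive and negative parts; on each part the powers are ordered like [x]
    and [y]. *)
Lemma chebyshev_pow {E : FAlg} (fc : frac_closed E) (x y : E) (m : nat) (s : R) :
  0 <= x -> 0 <= y -> (0 <= s < 1)%R ->
  0 <= (x - y) * (npow E x m * fracpow E x s - npow E y m * fracpow E y s).
Proof.
  intros Hx Hy Hs.
  assert (H1 := ppart_mul_pow_mono fc x y m s Hx Hy Hs).
  assert (H2 := ppart_mul_pow_mono fc y x m s Hy Hx Hs).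
  assert (H3 := le_addm _ _ _ _ H1 H2).
  rewrite <- (ppart_sub (x - y)).
  replace (- (x - y)) with (y - x) by lin.
  rewrite !mulDl, !mulDr, !mulNl, !mulNr. le_by H3.
Qed.

Lemma npow_mul_fracpow_convex {E : FAlg} (fc : frac_closed E) (x y : E)
    (m : nat) (s l k : R) :
  0 <= x -> 0 <= y -> (0 <= s < 1)%R -> (0 <= l)%R -> (0 <= k)%R -> (l + k = 1)%R ->
  npow E (l *: x + k *: y) (S m) * fracpow E (l *: x + k *: y) s <=
    l *: (npow E x (S m) * fracpow E x s) + k *: (npow E y (S m) * fracpow E y s).
Proof.
  intros Hx Hy Hs Hl Hk Hlk. set (z := l *: x + k *: y).
  assert (Hz : 0 <= z) by (now apply add_pos; apply scal_pos).
  induction m as [|m IH].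
  - simpl. rewrite !mul1r. now apply mul_fracpow_convex.
  - change (npow E ?a (S (S m))) with (a * npow E a (S m)).
    rewrite <- !mulA.
    assert (HC := chebyshev_pow fc x y (S m) s Hx Hy Hs).
    set (px := npow E x (S m) * fracpow E x s) in *.
    set (py := npow E y (S m) * fracpow E y s) in *.
    apply (le_trans E _ (z * (l *: px + k *: py))); [now apply le_mul_l|].
    (* The remaining gap [l x px + k y py - z (l px + k py)] equals [l k (x - y) (px - py)]. *)
    apply (le_scal E (l * k)) in HC; [|nra].
    assert (Hk' : k = (1 - l)%R) by lra.
    revert HC. unfold z. rewrite Hk'.
    rewrite !mulDl, !mulNl, !mulZl, !mulDr, !mulNr, !mulZr.
    intros HC. le_by HC.
Qed.

(** * Homogeneity and monotonicity of powers *)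

Lemma fracpow_scal {E : FAlg} (fc : frac_closed E) (x : E) (c s : R) :
  0 <= x -> (0 < c)%R -> (0 <= s < 1)%R ->
  fracpow E (c *: x) s <= Rpower c s *: fracpow E x s.
Proof.
  intros Hx Hc Hs. destruct (Req_dec s 0) as [->|Hs0].
  - rewrite !fracpow0, Rpower_O, scal1 by easy. apply le_refl.
  - assert (Hp : (0 < Rpower c s)%R) by apply exp_pos.
    apply (le_scal_inv (/ Rpower c s)); [now apply Rinv_0_lt_compat|].
    rewrite scalA, Rinv_l, scal1 by lra.
    apply fracpow_glb; [easy | easy | lra |]. intros t1 t2 H1 H2 H.
    apply (le_scal_inv (Rpower c s)); [easy|].
    rewrite scalA, Rinv_r, scal1 by lra.
    eapply le_trans.
    (* Rescaling the weights by [c^(s-1)] and [c^s] preserves the constraint and multiplies the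
       member for [x] by [c^s]. *)
    + apply (fracpow_lb fc (c *: x) s (Rpower c (s - 1) * t1) (Rpower c s * t2)).
      * apply scal_pos; [lra|easy].
      * lra.
      * apply Rmult_lt_0_compat; [apply exp_pos|easy].
      * now apply Rmult_lt_0_compat.
      * rewrite !ln_mult by (try apply exp_pos; easy). unfold Rpower.
        rewrite !ln_exp.
        transitivity (s * ln t1 + (1 - s) * ln t2)%R; [ring | easy].
    + assert (Hcs : (Rpower c s = c * Rpower c (s - 1))%R).
      { rewrite <- (Rpower_1 c Hc) at 2. rewrite <- Rpower_plus. f_equal. ring. }
      rewrite Hcs. rewrite scalDr, !scalA.
      match goal with |- ?a <= ?b => replace a with b by lin end. apply le_refl.
Qed.

Lemma npow_scal {E : FAlg} (x : E) (c : R) (m : nat) :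
  npow E (c *: x) m = (c ^ m) *: npow E x m.
Proof.
  induction m as [|m IH]; simpl; [now rewrite scal1|].
  rewrite IH, mulZl, mulZr. apply scalA.
Qed.

(** The integer part of [p] is at least one; writing it as [S m] exposes the factor [x] on which the
    convexity of [x * x ^ s] rests. *)
Lemma powE_gt1 {E : FAlg} (p : R) : (1 < p)%R ->
  exists (m : nat) (s : R), (0 <= s < 1)%R /\ (p = INR (S m) + s)%R /\
    forall x : E, powE E x p = npow E x (S m) * fracpow E x s.
Proof.
  intros Hp. destruct (base_Int_part p) as [H1 H2].
  assert (Hz : (0 < Int_part p)%Z).
  { apply lt_IZR. lra. }
  exists (pred (Z.to_nat (Int_part p))), (frac_part p).
  assert (Hm : S (pred (Z.to_nat (Int_part p))) = Z.to_nat (Int_part p)) by lia.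
  rewrite Hm. split; [|split].
  - destruct (base_fp p). lra.
  - rewrite INR_IZR_INZ, Z2Nat.id by lia. unfold frac_part. ring.
  - reflexivity.
Qed.

Lemma powE_lt1 {E : FAlg} (x : E) (r : R) :
  (0 < r < 1)%R -> powE E x r = fracpow E x r.
Proof.
  intros Hr. assert (H : Int_part r = 0%Z).
  { symmetry. apply Int_part_spec. simpl. lra. }
  unfold powE, frac_part. rewrite H. simpl. rewrite mul1l. f_equal. ring.
Qed.

Lemma powE_pos {E : FAlg} (fc : frac_closed E) (x : E) (p : R) :
  0 <= x -> (1 < p)%R -> 0 <= powE E x p.
Proof.
  intros Hx Hp. destruct (powE_gt1 (E := E) p Hp) as (m & s & Hs & _ & ->).
  apply mul_pos; [now apply npow_pos | now apply fracpow_pos].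
Qed.

Lemma powE_0 {E : FAlg} (p : R) : (1 < p)%R -> powE E 0 p = 0.
Proof.
  intros Hp. destruct (powE_gt1 (E := E) p Hp) as (m & s & _ & _ & ->).
  simpl. now rewrite !mul0l.
Qed.

Lemma powE_mono {E : FAlg} (fc : frac_closed E) (x y : E) (p : R) :
  0 <= x -> x <= y -> (1 < p)%R -> powE E x p <= powE E y p.
Proof.
  intros Hx Hxy Hp. assert (Hy := le_trans E _ _ _ Hx Hxy).
  destruct (powE_gt1 (E := E) p Hp) as (m & s & Hs & _ & HE). rewrite !HE.
  apply (le_trans E _ (npow E y (S m) * fracpow E x s)).
  - apply le_mul_r; [now apply fracpow_pos|].
    generalize (S m) as j. induction j as [|j IH]; simpl; [apply le_refl|].
    apply (le_trans E _ (x * npow E y j)); [now apply le_mul_l|].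
    apply le_mul_r; [now apply npow_pos | easy].
  - apply mul_fracpow_mono; try easy; [now apply npow_pos|].
    apply le_mul_l; [now apply npow_pos | easy].
Qed.

Lemma powE_scal {E : FAlg} (fc : frac_closed E) (x : E) (c p : R) :
  0 <= x -> (0 < c)%R -> (1 < p)%R -> powE E (c *: x) p <= Rpower c p *: powE E x p.
Proof.
  intros Hx Hc Hp.
  destruct (powE_gt1 (E := E) p Hp) as (m & s & Hs & -> & HE). rewrite !HE.
  rewrite npow_scal, mulZl, Rpower_plus, <- scalA, Rpower_pow by easy.
  apply le_scal; [now left; apply pow_lt|]. rewrite <- mulZr.
  apply le_mul_l; [now apply npow_pos | now apply fracpow_scal].
Qed.

(** Write [x + y = l (x / l) + k (y / k)] and apply convexity; homogeneity turns [l (x / l)^p] into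
    [l^(1-p) x^p]. *)
Lemma powE_add_le {E : FAlg} (fc : frac_closed E) (x y z : E) (p l k : R) :
  0 <= x -> 0 <= y -> 0 <= z -> z <= x + y -> (1 < p)%R ->
  (0 < l)%R -> (0 < k)%R -> (l + k = 1)%R ->
  powE E z p <= Rpower l (1 - p) *: powE E x p + Rpower k (1 - p) *: powE E y p.
Proof.
  intros Hx Hy Hz Hzxy Hp Hl Hk Hlk.
  assert (Hscal : forall (c : R) (t : E), (0 < c)%R -> 0 <= t ->
    c *: powE E (/ c *: t) p <= Rpower c (1 - p) *: powE E t p).
  { intros c t Hc Ht. replace (Rpower c (1 - p)) with (c * Rpower (/ c) p)%R.
    - rewrite <- scalA. apply le_scal; [lra|].
      apply powE_scal; try easy. now apply Rinv_0_lt_compat.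
    - unfold Rpower. rewrite ln_Rinv by easy. rewrite <- (exp_ln c Hc) at 1.
      rewrite <- exp_plus. f_equal. ring. }
  apply (le_trans E _ (powE E (x + y) p)); [now apply powE_mono|].
  apply (le_trans E _ (l *: powE E (/ l *: x) p + k *: powE E (/ k *: y) p));
    [|now apply le_addm; apply Hscal].
  assert (Hxy : x + y = l *: (/ l *: x) + k *: (/ k *: y)).
  { rewrite !scalA, !Rinv_r, !scal1 by lra. easy. }
  rewrite Hxy. destruct (powE_gt1 (E := E) p Hp) as (m & s & Hs & _ & HE).
  rewrite !HE. apply npow_mul_fracpow_convex; try lra; try easy;
    apply scal_pos; try easy; left; now apply Rinv_0_lt_compat.
Qed.

(** * Minkowski's inequality on the real part *)

Lemma inv_gt1 (p : R) : (1 < p -> 0 < 1 / p < 1)%R.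
Proof.
  intros Hp. split; [apply Rmult_lt_0_compat; [lra | apply Rinv_0_lt_compat; lra]|].
  apply (Rmult_lt_reg_r p); [lra|]. field_simplify; lra.
Qed.

Lemma fracpow_0l {E : FAlg} (fc : frac_closed E) (s : R) :
  (0 < s < 1)%R -> fracpow E 0 s <= 0.
Proof.
  intros Hs. apply (archi_eps _ 1). intros eps Heps.
  (* At [0] a member reduces to [(1 - s) t2]; [t2 = eps / (1 - s)] makes it [eps], and [exp l] is
     the [t1] that the constraint then forces. *)
  set (l := (- ((1 - s) / s * ln (eps / (1 - s))))%R).
  assert (Hd : (0 < eps / (1 - s))%R).
  { apply Rmult_lt_0_compat; [lra | apply Rinv_0_lt_compat; lra]. }
  eapply le_trans.
  - apply (fracpow_lb fc 0 s (exp l) (eps / (1 - s))); try easy.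
    + apply le_refl.
    + apply exp_pos.
    + rewrite ln_exp. unfold l. field. lra.
  - rewrite scal0r, add0.
    replace ((1 - s) * (eps / (1 - s)))%R with eps by (field; lra). apply le_refl.
Qed.

(* For weights [t2 = a] and [t2 = b] of [v] and [w], take the weight [a + b] for [u]. *)
Lemma root_subadd {E : FAlg} (fc : frac_closed E) (u v w : E) (p : R) :
  0 <= u -> 0 <= v -> 0 <= w -> (1 < p)%R ->
  (forall l k, (0 < l)%R -> (0 < k)%R -> (l + k = 1)%R ->
    u <= Rpower l (1 - p) *: v + Rpower k (1 - p) *: w) ->
  fracpow E u (1 / p) <= fracpow E v (1 / p) + fracpow E w (1 / p).
Proof.
  intros Hu Hv Hw Hp H.
  assert (Hr := inv_gt1 p Hp).
  assert (Hln : forall t1 t2, (0 < t1)%R ->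
    (1 / p * ln t1 + (1 - 1 / p) * ln t2 = 0)%R -> t1 = exp ((1 - p) * ln t2)).
  { intros t1 t2 H1 H2. rewrite <- (exp_ln t1 H1) at 1. f_equal.
    apply (Rmult_eq_reg_l (1 / p)); [|lra].
    transitivity (- ((1 - 1 / p) * ln t2))%R; [lra | field; lra]. }
  (* The two infima on the right are treated one after the other, each time with the other term
     moved to the left. *)
  assert (H1 : fracpow E u (1 / p) - fracpow E w (1 / p) <= fracpow E v (1 / p)).
  { apply fracpow_glb; try easy. intros t1 a Ht1 Ha Hta.
    assert (H2 : fracpow E u (1 / p)
      - ((1 / p * t1) *: v + ((1 - 1 / p) * a) *: 1) <= fracpow E w (1 / p)).
    { apply fracpow_glb; try easy. intros t1' b Ht1' Hb Htb.
      rewrite (Hln _ _ Ht1 Hta), (Hln _ _ Ht1' Htb).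
      assert (Hl : (0 < a / (a + b))%R)
        by (apply Rmult_lt_0_compat; [lra | apply Rinv_0_lt_compat; lra]).
      assert (Hk : (0 < b / (a + b))%R)
        by (apply Rmult_lt_0_compat; [lra | apply Rinv_0_lt_compat; lra]).
      set (th := exp ((1 - p) * ln (a + b))).
      assert (Hth : (0 < th)%R) by apply exp_pos.
      assert (H2 := fracpow_lb fc u (1 / p) th (a + b) Hu Hr Hth ltac:(lra)
        ltac:(unfold th; rewrite ln_exp; field; lra)).
      assert (H3 := H _ _ Hl Hk ltac:(field; lra)).
      apply (le_scal E (1 / p * th)) in H3; [|nra].
      assert (H4 := le_addm _ _ _ _ H2 H3).
      (* Factoring [c^(1-p)] through [(a+b)^(1-p)] makes the coefficients of [v] and [w] agree with
         those in [H3]. *)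
      assert (HE : forall c, (0 < c)%R ->
        exp ((1 - p) * ln c) = (th * Rpower (c / (a + b)) (1 - p))%R).
      { intros c Hc. unfold th, Rpower. rewrite <- exp_plus. f_equal.
        unfold Rdiv. rewrite ln_mult, ln_Rinv
          by (try apply Rinv_0_lt_compat; lra).
        ring. }
      rewrite (HE a Ha), (HE b Hb). le_by H4. }
    le_by H2. }
  le_by H1.
Qed.

Lemma minkowski_real {A B : FAlg} (fA : frac_closed A) (fB : frac_closed B)
    (T : A -> B) (p : R) (z x y : A) :
  (forall a b, T (a + b) = T a + T b) ->
  (forall c a, T (c *: a) = c *: T a) ->
  (forall a, 0 <= a -> 0 <= T a) ->
  (1 < p)%R -> 0 <= x -> 0 <= y -> 0 <= z -> z <= x + y ->
  powE B (T (powE A z p)) (1 / p) <=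
    powE B (T (powE A x p)) (1 / p) + powE B (T (powE A y p)) (1 / p).
Proof.
  intros HTD HTZ HTp Hp Hx Hy Hz Hzxy.
  assert (Hr := inv_gt1 p Hp).
  rewrite !(fun b : B => powE_lt1 b (1 / p) Hr).
  apply root_subadd; try easy; try (now apply HTp, powE_pos).
  intros l k Hl Hk Hlk. rewrite <- !HTZ, <- HTD.
  assert (H := powE_add_le fA x y z p l k Hx Hy Hz Hzxy Hp Hl Hk Hlk).
  apply le_0sub in H. apply HTp in H. rewrite HTD, oppE, HTZ in H.
  rewrite <- oppE in H. now apply le_sub0.
Qed.

(** * The algebra over K *)

Lemma abs_ge {E : FAlg} (x y : E) : x <= y -> - x <= y -> 0 <= y.
Proof.
  intros H1 H2. apply (le_scal_inv 2); [lra|].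
  assert (H := le_addm _ _ _ _ H1 H2). le_by H.
Qed.

Lemma is_sup_unique {E : FAlg} (S : E -> Prop) (x y : E) :
  is_sup E S x -> is_sup E S y -> x = y.
Proof. intros [H1 H2] [H3 H4]. apply le_anti; auto. Qed.

Lemma supE_eq {E : FAlg} (S : E -> Prop) (x : E) : is_sup E S x -> supE E S = x.
Proof.
  intros H. apply (is_sup_unique S); [|easy].
  apply (epsilon_spec (inhabits 0) (is_sup E S)). now exists x.
Qed.

Definition rotations {E : FAlg} (f g : E) : E -> Prop :=
  fun h => exists th : R, (0 <= th <= 2 * PI)%R /\ h = cos th *: f + sin th *: g.

Lemma supE_rotations {E : FAlg} (hE : vl_over KC E) (f g : E) :
  is_sup E (rotations f g) (supE E (rotations f g)).
Proof.
  destruct (hE f g) as [s Hs]. now rewrite (supE_eq (rotations f g) s Hs).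
Qed.

Lemma absK_emb (K : KField) (E : FAlg) (x : carK K E) :
  absK K E x = embK K E (reK K E (absK K E x)).
Proof. now destruct K. Qed.

Lemma absK_pos (K : KField) (E : FAlg) (hE : vl_over K E) (x : carK K E) :
  0 <= reK K E (absK K E x).
Proof.
  destruct K; simpl in *.
  - apply (abs_ge x); [apply join_ubl | apply join_ubr].
  - destruct (supE_rotations hE (fst x) (snd x)) as [H _].
    assert (Hpi := PI_RGT_0).
    (* The angles [0] and [PI] put [fst x] and [- fst x] below the modulus. *)
    apply (abs_ge (fst x)); apply H.
    + exists 0%R. rewrite cos_0, sin_0, scal1, scal0l, addr0. split; [lra|easy].
    + exists PI. rewrite cos_PI, sin_PI, scal0l, addr0, oppE. split; [lra|easy].
Qed.

Lemma absK_add (K : KField) (E : FAlg) (hE : vl_over K E) (x y : carK K E) :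
  reK K E (absK K E (addK K E x y)) <=
    reK K E (absK K E x) + reK K E (absK K E y).
Proof.
  destruct K; simpl in *.
  - apply join_lub.
    + apply le_addm; apply join_ubl.
    + replace (- (x + y)) with (- x + - y) by lin. apply le_addm; apply join_ubr.
  - destruct (supE_rotations hE (fst x) (snd x)) as [Hx _].
    destruct (supE_rotations hE (fst y) (snd y)) as [Hy _].
    apply (supE_rotations hE (fst x + fst y) (snd x + snd y)).
    intros h (th & Hth & ->).
    replace (cos th *: (fst x + fst y) + sin th *: (snd x + snd y)) with
      ((cos th *: fst x + sin th *: snd x) + (cos th *: fst y + sin th *: snd y))
      by lin.
    apply le_addm; [apply Hx | apply Hy]; now exists th.
Qed.

(** Over [KC] the rotations of [a + i0] are the multiples [cos th *: a], the largest being at angle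
    [0]. *)
Lemma absK_id (K : KField) (E : FAlg) (a : E) :
  0 <= a -> absK K E (embK K E a) = embK K E a.
Proof.
  intros Ha. destruct K; simpl.
  - apply le_anti; [|apply join_ubl].
    apply join_lub; [apply le_refl|].
    assert (H := add_pos _ _ Ha Ha). le_by H.
  - f_equal. apply (supE_eq (rotations a 0)). split.
    + intros h (th & _ & ->). rewrite scal0r, addr0.
      rewrite <- (scal1 E a) at 2. apply le_scal_l; [apply COS_bound | easy].
    + intros z H. apply H. exists 0%R.
      assert (Hpi := PI_RGT_0).
      rewrite cos_0, scal1, scal0r, addr0. split; [lra|easy].
Qed.

Lemma posK_emb (K : KField) (E : FAlg) (hE : vl_over K E) (x : carK K E) :
  posK K E x -> x = embK K E (reK K E x) /\ 0 <= reK K E x.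
Proof.
  intros H. unfold posK in H. split.
  - rewrite <- H. apply absK_emb.
  - rewrite <- H. now apply absK_pos.
Qed.

Lemma wgm_frac_closed (K : KField) (E : FAlg) : wgm_closed K E -> frac_closed E.
Proof.
  intros wE a s Ha Hs.
  (* Two entries [a] and [1] with weights [s] and [1 - s]; [add0] and [Rmult_1_l] later remove the
     initial [0] and [1] of the sums and products. *)
  destruct (wE 2%nat (fun k => match k with O => embK K E a | _ => embK K E 1 end)
    (fun k => match k with O => s | _ => (1 - s)%R end)) as [x [Hlb Hglb]].
  - intros [|k] _; lra.
  - simpl. lra.
  - assert (Hre : forall b : E, 0 <= b -> reK K E (absK K E (embK K E b)) = b).
    { intros b Hb. rewrite absK_id by easy. now destruct K. }
    simpl in Hlb, Hglb. rewrite !Hre in * by (easy || apply one_pos).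
    exists x. split.
    + intros h (t1 & t2 & H1 & H2 & H3 & ->). apply Hlb.
      exists (fun k => match k with O => t1 | _ => t2 end). split; [|split].
      * now intros [|k] _.
      * now rewrite Rmult_1_l.
      * now rewrite add0.
    + intros z H. apply Hglb. intros h (th & H1 & H2 & ->). apply H.
      exists (th O), (th 1%nat). rewrite add0. rewrite Rmult_1_l in H2.
      repeat split; auto with arith.
Qed.

Lemma sumK_emb (K : KField) (E : FAlg) (n : nat) (f : nat -> E) :
  sumK K E n (fun k => embK K E (f k)) = embK K E (sumE E n f).
Proof.
  induction n as [|n IH]; simpl; [now destruct K|].
  rewrite IH. destruct K; simpl; [easy|]. now rewrite add0.
Qed.

Lemma leK_emb (K : KField) (E : FAlg) (x y : E) :
  x <= y -> leK K E (embK K E x) (embK K E y).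
Proof. now destruct K. Qed.

Lemma addK_emb (K : KField) (E : FAlg) (x y : E) :
  addK K E (embK K E x) (embK K E y) = embK K E (x + y).
Proof. destruct K; simpl; [easy|]. now rewrite add0. Qed.

Lemma reK_add (K : KField) (E : FAlg) (x y : carK K E) :
  reK K E (addK K E x y) = reK K E x + reK K E y.
Proof. now destruct K. Qed.

(** Embeds the reals in the scalar field, so that K-linearity of a map yields real linearity. *)
Definition rscalar (K : KField) : R -> scalar K :=
  match K with KR => fun c => c | KC => fun c => (c, 0%R) end.

Lemma scalK_emb (K : KField) (E : FAlg) (c : R) (x : E) :
  scalK K E (rscalar K c) (embK K E x) = embK K E (c *: x).
Proof.
  destruct K; simpl; [easy|]. f_equal; lin.
Qed.

Lemma reK_scal (K : KField) (E : FAlg) (c : R) (x : carK K E) :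
  reK K E (scalK K E (rscalar K c) x) = c *: reK K E x.
Proof. destruct K; simpl; [easy|]. lin. Qed.

Open Scope R_scope.

Theorem theorem5p1 (K : KField) (A B : FAlg) (p : R) (hp : 1 < p)
  (hA : vl_over K A) (hB : vl_over K B)
  (wA : wgm_closed K A) (wB : wgm_closed K B)
  (T : carK K A -> carK K B) (hT : K_linear K A B T) (hTpos : positive_map K A B T)
  (n : nat) (a : nat -> carK K A) :
  leK K B
    (powK K B (T (powK K A (absK K A (sumK K A n a)) p)) (1 / p))
    (sumK K B n (fun k => powK K B (T (powK K A (absK K A (a k)) p)) (1 / p))).
Proof.
  assert (fA := wgm_frac_closed K A wA). assert (fB := wgm_frac_closed K B wB).
  destruct hT as [hTD hTZ].
  (* [powK] reads only the real part of its argument, so both sides can be expressed through this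
     positive real-linear map. *)
  set (T' := fun x : A => reK K B (T (embK K A x))).
  assert (HTD : forall x y, T' (add x y) = add (T' x) (T' y)).
  { intros x y. unfold T'. now rewrite <- addK_emb, hTD, reK_add. }
  assert (HTZ : forall c x, T' (scal c x) = scal c (T' x)).
  { intros c x. unfold T'. now rewrite <- scalK_emb, hTZ, reK_scal. }
  assert (HTp : forall x, le zero x -> le zero (T' x)).
  { intros x Hx. apply posK_emb, hTpos; [easy|]. now apply absK_id. }
  unfold powK. rewrite sumK_emb. apply leK_emb.
  change (le (powE B (T' (powE A (reK K A (absK K A (sumK K A n a))) p)) (1 / p))
    (sumE B n (fun k => powE B (T' (powE A (reK K A (absK K A (a k))) p)) (1 / p)))).
  induction n as [|n IH]; simpl.
  (* For the empty sum the claim is that the root of [T' 0 = 0] is at most [0]. *)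
  - assert (H0 : zeroK K A = embK K A zero) by now destruct K.
    rewrite H0, absK_id by apply le_refl.
    assert (H1 : reK K A (embK K A zero) = zero) by now destruct K.
    rewrite H1, powE_0 by easy.
    assert (H2 : T' zero = zero).
    { rewrite <- (scal0l (zero : A)), HTZ. apply scal0l. }
    assert (Hr := inv_gt1 p hp).
    rewrite H2, powE_lt1 by easy. now apply fracpow_0l.
  (* The two-term inequality is applied to the moduli of the partial sum and of the last term, with
     [z] the modulus of their sum. *)
  - eapply le_trans; [|apply le_add; exact IH].
    apply minkowski_real; try easy; try now apply absK_pos.
    now apply absK_add.
Qed.
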